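(* Let $x,y\in X$ and write $i=\partial(x,y)$. Then $$\langle\widehat{x},\widehat{y}\rangle=[n][k-i]-[k]^2.$$
   Context: Let $\mathbb{F}_q$ be a finite field with $q$ elements, let $n,k$ be integers with $n>2k\geq 6$, and let $V$ be an $n$-dimensional vector space over $\mathbb{F}_q$. For $m\in\mathbb{Z}$ write $[m]=(q^m-1)/(q-1)$. Let $P$ be the set of all subspaces of $V$ and $P_\ell$ the set of $\ell$-dimensional subspaces; put $X=P_k$. The Grassmann graph $\Gamma=J_q(n,k)$ has vertex set $X$, with $x,y\in X$ adjacent iff $\dim(x\cap y)=k-1$; $\partial$ is its path-length distance. Let $E$ be a (real) Euclidean space of dimension $[n]-1$ with inner product $\langle\,,\,\rangle$, and let $P_1\to E$, $s\mapsto\widehat{s}$ be a map such that: $E=\mathrm{Span}\{\widehat{s}\mid s\in P_1\}$; $\|\widehat{s}\|^2=[n]-1$ for $s\in P_1$; $\langle\widehat{s},\widehat{t}\rangle=-1$ for distinct $s,t\in P_1$; and $\sum_{s\in P_1}\widehat{s}=0$. For $u\in P$ define $\widehat{u}=\sum_{s\in P_1,\,s\subseteq u}\widehat{s}$. *)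

(* Defs.v *)
From HB Require Import structures.
From mathcomp Require Import all_boot all_order all_algebra.
From mathcomp Require Export sesquilinear.
From mathcomp Require Import reals.

Set Implicit Arguments.
Unset Strict Implicit.
Unset Printing Implicit Defensive.

Import Order.TTheory GRing.Theory Num.Theory.

Section PathDistance.
Variables (T : finType) (e : rel T).

Definition walk (m : nat) (x y : T) : bool :=
  [exists p : m.-tuple T, path e x p && (last x p == y)].

(* A shortest walk has fewer than #|T| steps, so the search is exhaustive;
   the value is #|T| exactly when x and y are in different components. *)
Definition gdist (x y : T) : nat :=
  find (fun m => walk m x y) (iota 0 #|T|).

Lemma walkP m x y :
  reflect (exists p : seq T, [/\ size p = m, path e x p & last x p = y])
          (walk m x y).
Proof.
apply: (iffP existsP) => [[p /andP[ep /eqP <-]]|[p [sz ep <-]]].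
  by exists p; rewrite size_tuple.
by exists (Tuple (introT eqP sz)); rewrite ep eqxx.
Qed.

Lemma gdist_min x p : path e x p -> gdist x (last x p) <= size p.
Proof.
move=> ep; rewrite leqNgt; apply/negP => lt_p.
have lt_pT : size p < #|T|.
  by apply: leq_trans lt_p _; rewrite -[leqRHS](size_iota 0) find_size.
have /walkP wp : exists p' : seq T,
    [/\ size p' = size p, path e x p' & last x p' = last x p] by exists p.
by have := before_find 0 lt_p; rewrite nth_iota // add0n wp.
Qed.

Lemma gdist_walk x y : connect e x y -> walk (gdist x y) x y.
Proof.
case/connectP => p0 /shortenP[p ep Up _] ->.
have lt_pT : size p < #|T|.
  by have := max_card (mem (x :: p)); rewrite (card_uniqP Up).
have hs : has (fun m => walk m x (last x p)) (iota 0 #|T|).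
  apply/hasP; exists (size p); first by rewrite mem_iota.
  by apply/walkP; exists p.
have := nth_find 0 hs; rewrite nth_iota ?add0n //.
by rewrite -[ltnRHS](size_iota 0) -has_find.
Qed.

Lemma gdist_disconnected x y : ~~ connect e x y -> gdist x y = #|T|.
Proof.
move=> nc; rewrite /gdist hasNfind ?size_iota //; apply/hasPn => m _.
apply: contra nc => /walkP[p [_ ep <-]].
by apply/connectP; exists p.
Qed.

End PathDistance.

Section VspaceFinite.
Import VectorInternalTheory.
Variables (F : finFieldType) (V : vectType F).

HB.instance Definition _ := [Countable of {vspace V} by <:].
HB.instance Definition _ := [Finite of {vspace V} by <:].

End VspaceFinite.

Section Subspaces.
Variables (F : finFieldType) (V : vectType F) (l : nat).

Definition subspaces := {u : {vspace V} | \dim u == l}.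

HB.instance Definition _ := [isSub of subspaces for sval].
HB.instance Definition _ := [Finite of subspaces by <:].

End Subspaces.

Definition grassmann_adj (F : finFieldType) (V : vectType F) (k : nat) :
  rel (subspaces V k) :=
  fun x y => \dim (val x :&: val y)%VS == k.-1.

Local Open Scope ring_scope.

Definition qnum (R : fieldType) (q : nat) (m : int) : R :=
  (q%:R ^ m - 1) / (q%:R - 1).

Definition hat (F : finFieldType) (V : vectType F) (R : realType)
    (E : vectType R) (f : subspaces V 1 -> E) (u : {vspace V}) : E :=
  \sum_(s : subspaces V 1 | (val s <= u)%VS) f s.

(* Main.v *)
Require Import Defs.
From HB Require Import structures.
From mathcomp Require Import all_boot all_order all_algebra.
From mathcomp Require Import reals finfield zify.

Set Implicit Arguments.
Unset Strict Implicit.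
Unset Printing Implicit Defensive.

Import GRing.Theory Num.Theory.

Local Open Scope ring_scope.

(** The inner product of two hats is a sum over pairs of points: each pair
    contributes -1, and each coincident pair contributes [n] more.  Hence for
    any subspaces u and v,
      <hat u, hat v> = [n] * c (u :&: v) - c u * c v,
    where c w is the number of points (1-spaces) contained in w; this is
    [dot_hat].  Two facts turn this into the formula.

    A subspace of dimension d contains [d] points ([points_natr]), because its
    q ^ d - 1 nonzero vectors are shared out among the points, q - 1 to each.

    In the Grassmann graph, d(x, y) = k - dim (x :&: y) ([gdist_grassmann]).
    Along one edge the dimension of the intersection with a fixed subspace
    changes by at most 1, so no walk is shorter than that; conversely, when
    x <> y, replacing x by a hyperplane of x plus a line of y gives a neighbour
    of x that meets y in one more dimension ([closer_neighbour]), so a walk of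
    that length exists. *)

(** * Counting the points of a subspace *)

Section Points.
Variables (F : finFieldType) (V : vectType F).
Implicit Types (u w : {vspace V}) (s : subspaces V 1).

Definition points u : {set subspaces V 1} := [set s | (val s <= u)%VS].

Lemma pointsI u w : points u :&: points w = points (u :&: w)%VS.
Proof. by apply/setP=> s; rewrite !inE subv_cap. Qed.

(** V carries no finite type structure of its own; [finvect_type V] is V with
    one, under which the vectors of u can be counted. *)
Lemma card_nonzero u :
  #|[set v : finvect_type V | (v \in u) && (v != 0)]| = (#|F| ^ \dim u).-1.
Proof.
have <- : #|[set v : finvect_type V | v \in u]| = (#|F| ^ \dim u)%N.
  (* The vector structures of V and of its alias are convertible only once the
     record V is taken apart. *)
  case: V u => T cvT u; rewrite cardsE.
  exact: (@card_vspace F (finvect_type (Vector.Pack cvT)) cvT u).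
rewrite [in RHS](cardsD1 (0 : finvect_type V)) inE.
have -> : (0 : finvect_type V) \in u by exact: mem0v.
rewrite add1n /=; apply: eq_card => v; rewrite !inE; exact: andbC.
Qed.

Lemma point_of_vector s (v : V) :
  v != 0 -> (v \in val s) = (val s == <[v]>%VS).
Proof.
move=> v0; apply/idP/eqP => [vs|->]; last exact: memv_line.
apply/esym/eqP; rewrite eqEdim -memvE vs dim_vline v0.
by rewrite (eqP (valP s)).
Qed.

(** Double counting of the pairs (v, s) with v a nonzero vector of u and s the
    point spanned by v. *)
Lemma card_points u : (#|points u| * #|F|.-1 = (#|F| ^ \dim u).-1)%N.
Proof.
rewrite -card_nonzero -sum_nat_const -[RHS]sum1_card.
transitivity (\sum_(s in points u)
    \sum_(v : finvect_type V | [&& v \in u, v != 0%R & v \in val s]) 1)%N.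
  apply: eq_bigr => s; rewrite inE => su.
  have -> : #|F|.-1 = (#|F| ^ \dim (val s)).-1 by rewrite (eqP (valP s)) expn1.
  rewrite sum1_card -card_nonzero cardsE; apply: eq_card => v.
  apply/andP/and3P => [[vs v0]|[_ v0 vs]]; split=> //.
  exact: (subvP su).
rewrite (exchange_big_dep (fun v : finvect_type V => (v \in u) && (v != 0))) /=;
  last by move=> s v _ /and3P[-> ->].
rewrite [RHS](eq_bigl (fun v : finvect_type V => (v \in u) && (v != 0)));
  last by move=> v; rewrite inE.
apply: eq_bigr => v /andP[vu v0].
have dv : \dim <[v : V]> == 1%N by rewrite dim_vline v0.
rewrite (big_pred1 (Sub <[v : V]>%VS dv : subspaces V 1)) // => s.
rewrite inE vu v0 point_of_vector // -[RHS]val_eqE SubK /=.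
by case: eqP => [->|]; rewrite ?andbF // andbT -memvE.
Qed.

Lemma points_natr (R : realType) u :
  (#|points u|)%:R = qnum R #|F| (\dim u).
Proof.
have q1 : (1 < #|F|)%N := card_finNzRing_gt1 F.
have qd : (0 < #|F| ^ \dim u)%N by rewrite expn_gt0 ltnW.
have q1R : (#|F|%:R - 1 : R) != 0 by rewrite subr_eq0 (eqr_nat R _ 1) gtn_eqF.
apply: (mulIf q1R); rewrite /qnum divfK //.
have := congr1 (fun m : nat => m%:R : R) (card_points u).
rewrite -!subn1 natrM !natrB //; last exact: ltnW.
by rewrite natrX.
Qed.

End Points.

(** * Distance in the Grassmann graph *)

Section Distance.
Variables (F : finFieldType) (V : vectType F).
Implicit Types (u w : {vspace V}).

(** Remove one line l from a complement c of u in w; then h = u + (c :\: l). *)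
Lemma hyperplane_above u w : (u <= w)%VS -> u != w ->
  exists h : {vspace V}, [/\ (u <= h)%VS, (h <= w)%VS & (\dim h).+1 = \dim w].
Proof.
move=> uw neq.
set c := (w :\: u)%VS; set l := <[vpick c]>%VS.
have c0 : c != 0%VS.
  by apply: contra neq; rewrite diffv_eq0 => wu; rewrite eqEsubv uw.
have lc : (l <= c)%VS by rewrite -memvE memv_pick.
have dl : \dim l = 1%N by rewrite dim_vline vpick0 c0.
exists (u + (c :\: l))%VS; split; first exact: addvSl.
  by rewrite subv_add uw (subv_trans (diffvSl _ _)) ?diffvSl.
have du : (u :&: (c :\: l) = 0)%VS.
  apply/eqP; rewrite -subv0 -(capv_diff w u) capvC.
  by apply: capvS => //; apply: diffvSl.
rewrite dimv_disjoint_sum //.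
have := dimv_cap_compl c l; rewrite (capv_idPr lc) dl.
have := dimv_cap_compl w u; rewrite (capv_idPr uw) -/c; lia.
Qed.

Variable k : nat.
Implicit Types (x y z : subspaces V k).

Local Notation adj := (@grassmann_adj F V k).

Lemma dim_val x : \dim (val x) = k. Proof. exact/eqP/(valP x). Qed.

(** Keep a hyperplane of x that contains the intersection of x and y, and add to
    it a vector of y outside x. *)
Lemma closer_neighbour x y : x != y ->
  exists2 z, adj x z & (\dim (val x :&: val y) < \dim (val z :&: val y))%N.
Proof.
move=> neq.
have nyx : ~~ (val y <= val x)%VS.
  apply: contra neq => yx; rewrite eq_sym -val_eqE eqEdim yx.
  by rewrite !dim_val leqnn.
have ncap : (val x :&: val y)%VS != val x.
  apply: contra neq => /eqP/capv_idPl xy.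
  by rewrite -val_eqE eqEdim xy !dim_val leqnn.
have [h [uh hx dh]] := hyperplane_above (capvSl (val x) (val y)) ncap.
have /subvPn[v vy vx] := nyx.
have v0 : v != 0 by apply: contraNneq vx => ->; apply: mem0v.
have sub_line (w : {vspace V}) : (w <= val x)%VS -> (w :&: <[v]> = 0)%VS.
  move=> wx; apply/eqP; rewrite -subv0; apply/subvP=> a.
  rewrite memv_cap memv0 => /andP[/(subvP wx) ax /vlineP[c ca]].
  case: (eqVneq c 0) => [c0|c0]; first by rewrite ca c0 scale0r.
  by case/negP: vx; rewrite -(scalerK c0 v) -ca memvZ.
have dz : \dim (h + <[v]>) == k.
  by rewrite dimv_disjoint_sum ?sub_line // dim_vline v0 addn1 dh dim_val.
have zE : val (Sub (h + <[v]>)%VS dz : subspaces V k) = (h + <[v]>)%VS.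
  exact: SubK.
exists (Sub (h + <[v]>)%VS dz); rewrite ?/grassmann_adj zE.
  (* The intersection with x contains h, and is not all of x because v is in
     the dimension-k space h + <[v]> but not in x. *)
  have hle : (h <= val x :&: (h + <[v]>))%VS by rewrite subv_cap hx addvSl.
  have := dimvS hle; have := dimvS (capvSl (val x) (h + <[v]>)%VS).
  have ne : \dim (val x :&: (h + <[v]>)) != \dim (val x).
    apply: contraNneq vx => dcap.
    have xz : (val x <= h + <[v]>)%VS.
      by apply/capv_idPl/eqP; rewrite eqEdim capvSl dcap leqnn.
    have /eqP -> : val x == (h + <[v]>)%VS.
      by rewrite eqEdim xz (eqP dz) dim_val leqnn.
    by rewrite memvE addvSr.
  move: ne dh; rewrite dim_val; lia.
have le : ((val x :&: val y) + <[v]> <= (h + <[v]>) :&: val y)%VS.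
  by rewrite subv_cap addvS //= subv_add capvSr -memvE vy.
apply: leq_trans (dimvS le).
by rewrite dimv_disjoint_sum ?sub_line ?capvSl // dim_vline v0 addn1.
Qed.

(** Since x :&: z has codimension at most 1 in z, its intersection with z :&: w,
    which lies in x :&: w, has codimension at most 1 in z :&: w. *)
Lemma dim_cap_adj x z w : adj x z ->
  (\dim (val z :&: w) <= (\dim (val x :&: w)).+1)%N.
Proof.
move=> /eqP dxz.
have := dimv_sum_cap (val z :&: w) (val x :&: val z).
have : (\dim ((val z :&: w) + (val x :&: val z)) <= k)%N.
  by rewrite -[leqRHS](dim_val z) dimvS // subv_add capvSl capvSr.
have : (\dim ((val z :&: w) :&: (val x :&: val z)) <= \dim (val x :&: w))%N.
  apply: dimvS; rewrite subv_cap (subv_trans (capvSr _ _)) ?capvSl //.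
  by rewrite (subv_trans (capvSl _ _)) ?capvSr.
rewrite dxz; lia.
Qed.

Lemma path_dim_cap x p : path adj x p ->
  (k <= \dim (val x :&: val (last x p)) + size p)%N.
Proof.
elim: p x => [|z p IH] x /=; first by rewrite capvv dim_val addn0.
case/andP=> xz /IH le; apply: (leq_trans le).
by rewrite addnS -addSn leq_add2r dim_cap_adj.
Qed.

Lemma short_path x y : exists p,
  [/\ path adj x p, last x p = y & (size p + \dim (val x :&: val y) <= k)%N].
Proof.
have [m] := ubnP (k - \dim (val x :&: val y)); elim: m x => // m IH x lt_m.
have [-> | neq] := eqVneq x y.
  by exists [::]; rewrite capvv dim_val.
have [z xz lt] := closer_neighbour neq.
have := dimvS (capvSl (val z) (val y)); rewrite dim_val => lek.
have [|p [zp lp le]] := IH z; first by lia.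
exists (z :: p); split=> //; first exact/andP.
by apply: leq_trans le; rewrite [size _]/= addSnnS leq_add2l.
Qed.

Lemma gdist_grassmann x y :
  (gdist adj x y + \dim (val x :&: val y) = k)%N.
Proof.
have [p [xp lp le]] := short_path x y.
have up := gdist_min xp; rewrite lp in up.
have /gdist_walk/walkP[p' [sz xp' lp']] : connect adj x y.
  by apply/connectP; exists p.
apply/eqP; rewrite eqn_leq (leq_trans _ le) ?leq_add2r //= addnC -sz -lp'.
exact: path_dim_cap.
Qed.

End Distance.

(** * The inner product of two hats *)

Lemma sum_indicator (R : pzSemiRingType) (T : finType) (A B : {set T}) :
  \sum_(t in A) (t \in B)%:R = #|A :&: B|%:R :> R.
Proof.
rewrite -natr_sum -sum1_card; congr (_%:R).
under [RHS]eq_bigl do rewrite inE.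
by rewrite big_mkcondr; apply: eq_bigr => t _; case: (t \in B).
Qed.

(** Summing the Gram matrix N * (s == t) - 1 over s in u and t in w: the diagonal
    contributes N for each point common to u and w. *)
Lemma dot_hat (F : finFieldType) (V : vectType F) (R : realType)
    (E : vectType R) (ip : {dot E for idfun}) (f : subspaces V 1 -> E) (N : R)
    (normf : forall s : subspaces V 1, ip (f s) (f s) = N - 1)
    (ipf : forall s t : subspaces V 1, s <> t -> ip (f s) (f t) = -1)
    (u w : {vspace V}) :
  ip (hat f u) (hat f w) =
    N * (#|points (u :&: w)%VS|)%:R
    - (#|points u|)%:R * (#|points w|)%:R.
Proof.
have ipE s t : ip (f s) (f t) = N * (s == t)%:R - 1.
  by case: eqP => [->|/ipf->]; rewrite ?normf ?mulr1 ?mulr0 ?sub0r.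
have hatE v : hat f v = \sum_(s in points v) f s.
  by apply: eq_bigl => s; rewrite inE.
rewrite !hatE linear_sumlz.
transitivity (\sum_(s in points u)
    (N * (s \in points w)%:R - (#|points w|)%:R)).
  apply: eq_bigr => s _; rewrite linear_sumr /=.
  under eq_bigr do rewrite ipE.
  rewrite big_split /= sumrN sumr_const -mulr_sumr; congr (N * _ - _).
  rewrite (eq_bigr (fun t => (t \in [set s])%:R)) ?sum_indicator => [|t _].
    have [sw|sw] := boolP (s \in points w).
      by rewrite (setIidPr _) ?sub1set // cards1.
    by rewrite disjoint_setI0 ?cards0 // disjoint_sym disjoints1.
  by rewrite inE eq_sym.
rewrite big_split /= sumrN sumr_const -mulr_sumr mulr_natl.
by rewrite sum_indicator pointsI.
Qed.

Theorem lemma6p4 (F : finFieldType) (V : vectType F) (n k : nat)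
  (R : realType) (E : vectType R) (ip : {dot E for idfun})
  (f : subspaces V 1 -> E)
  (dimV : \dim {:V} = n)
  (hk : (6 <= 2 * k)%N) (hn : (2 * k < n)%N)
  (dimE : (\dim {:E})%:R = qnum R #|F| n - 1)
  (spanE : <<codom f>>%VS = {:E}%VS)
  (normf : forall s : subspaces V 1, ip (f s) (f s) = qnum R #|F| n - 1)
  (ipf : forall s t : subspaces V 1, s <> t -> ip (f s) (f t) = -1)
  (sumf : \sum_(s : subspaces V 1) f s = 0)
  (x y : subspaces V k) (i : nat)
  (hi : i = gdist (@grassmann_adj F V k) x y) :
  ip (hat f (val x)) (hat f (val y)) =
    qnum R #|F| n * qnum R #|F| (k%:Z - i%:Z) - qnum R #|F| k ^+ 2.
Proof.
have kE : k%:Z - i%:Z = (\dim (val x :&: val y))%:Z.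
  by have := gdist_grassmann x y; rewrite -hi; lia.
by rewrite (dot_hat normf ipf) !points_natr !dim_val kE expr2.
Qed.
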